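(* For all $c_1,c_2\in\mathbb{C}$, the system $$\frac{dX}{dt}=-XY,\qquad \frac{dY}{dt}=(2X+Y-Z)Y,\qquad \frac{dZ}{dt}=Z^2+8XZ-20XY-20X^2$$ admits the special solution $$(X,Y,Z)=\bigl(c_1,\;0,\;-6c_1\tanh\bigl(6(c_1t-c_1c_2)\bigr)-4c_1\bigr).$$
   Context: $X,Y,Z$ are unknown complex functions of the complex variable $t$. (This system is obtained from the Chazy III equation $u'''=2uu''-3(u')^2$ by $X=u/6$, $Y=-u'/u$, $Z=-u''/u'+u/3$.) *)

(* Defs.v *)
(* Stdlib reals with Coquelicot's complex numbers. *)
From Stdlib Require Import Reals.
From Coquelicot Require Import Coquelicot.

Local Open Scope C_scope.

(* exp (x + i y) = e^x (cos y + i sin y). *)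
Definition Cexp (z : C) : C :=
  (exp (Re z) * cos (Im z), exp (Re z) * sin (Im z))%R.

Definition Csinh (z : C) : C := (Cexp z - Cexp (- z)) / 2.
Definition Ccosh (z : C) : C := (Cexp z + Cexp (- z)) / 2.

(* Meaningful only where [Ccosh z <> 0]; elsewhere [Cdiv] returns a junk value. *)
Definition Ctanh (z : C) : C := Csinh z / Ccosh z.

(* [is_derive] over [C] is the complex derivative: the domain scalar field is
   [C_AbsRing], so each equation below includes complex differentiability
   at [t]. *)
Definition is_C_derive (f : C -> C) (t l : C) : Prop :=
  @is_derive C_AbsRing C_NormedModule f t l.

Definition is_solution_on (D : C -> Prop) (X Y Z : C -> C) : Prop :=
  open D /\ (exists t, D t) /\
  forall t, D t ->
    is_C_derive X t (- X t * Y t) /\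
    is_C_derive Y t ((2 * X t + Y t - Z t) * Y t) /\
    is_C_derive Z t
      (Z t ^ 2 + 8 * X t * Z t - 20 * X t * Y t - 20 * X t ^ 2).

(* Main.v *)
Require Import Defs.
From Stdlib Require Import Reals Lra.
From Coquelicot Require Import Coquelicot.

(** With [T = Ctanh (6 (c1 t - c1 c2))] and [Z = - 6 c1 T - 4 c1], the whole
    content is the third equation: the cross terms in [T] cancel and
    [Z^2 + 8 c1 Z - 20 c1^2 = 36 c1^2 (T^2 - 1)], which is the derivative of [Z]
    because [tanh' = 1 - tanh^2] and the inner function has slope [6 c1].

    The complex derivative of [Ctanh] rests on that of [Cexp]. The addition
    formula [Cexp_plus] reduces the latter to the estimate
    [Cexp h = 1 + h + o(h)] at the origin ([Cexp_first_order]), which is read off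
    from the real derivatives of [exp], [cos] and [sin] at [0]. The derivatives of
    [Csinh] and [Ccosh] follow by linearity, and that of the quotient from the
    product rule and the derivative of the inverse ([is_C_ring_derive_inv]).

    The domain is open because [Ccosh], being differentiable, is continuous, and
    it contains [t = c2], where the argument vanishes and [Ccosh 0 = 1]. *)

Local Open Scope C_scope.

(** * Complex differentiation rules *)

(** The chain and product rules need source and target to carry the same
    uniform structure. [C_NormedModule] carries the product structure of the
    plane, whereas the source of a complex derivative carries the one induced by
    [Cmod]; the latter is used on both sides here. *)
Definition is_C_ring_derive (f : C -> C) (z l : C) : Prop :=
  @is_derive C_AbsRing (AbsRing_NormedModule C_AbsRing) f z l.

(** Differentiability involves the target only through its module operations and
    its norm, and these are the same for the two structures. *)
Lemma is_C_derive_of_ring (f : C -> C) (z l : C) :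
  is_C_ring_derive f z l -> is_C_derive f z l.
Proof.
  intros [[Hplus Hscal Hnorm] Hdomin].
  split; [ split; assumption | exact Hdomin ].
Qed.

Lemma is_C_ring_derive_bound (f : C -> C) (z l : C) :
  (forall eps : R, (0 < eps)%R -> exists delta : R, (0 < delta)%R /\
     forall h : C, (Cmod h < delta)%R ->
       (Cmod (f (z + h) - f z - h * l)%C <= eps * Cmod h)%R) ->
  is_C_ring_derive f z l.
Proof.
  intros H; split.
  - exact (@is_linear_scal_l C_AbsRing (AbsRing_NormedModule C_AbsRing) l).
  - intros x Hx eps.
    rewrite <- (@is_filter_lim_locally_unique C_AbsRing
                  (AbsRing_NormedModule C_AbsRing) z x Hx).
    destruct (H eps (cond_pos eps)) as [delta [Hdelta Hbound]].
    exists (mkposreal delta Hdelta); intros y Hy.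
    assert (Hsub : forall u v : C, v + (u - v) = u) by (intros; ring).
    specialize (Hbound (y - z) Hy).
    rewrite (Hsub y z) in Hbound.
    exact Hbound.
Qed.

Lemma is_C_ring_derive_eq (f : C -> C) (z l l' : C) :
  is_C_ring_derive f z l -> l = l' -> is_C_ring_derive f z l'.
Proof. intros H <-; exact H. Qed.

Lemma is_C_ring_derive_affine (a b z : C) :
  is_C_ring_derive (fun t => a * t + b) z a.
Proof.
  apply is_C_ring_derive_bound; intros eps Heps.
  exists 1%R; split; [ exact Rlt_0_1 | intros h _ ].
  replace (a * (z + h) + b - (a * z + b) - h * a) with (RtoC 0) by ring.
  rewrite Cmod_0.
  apply Rmult_le_pos; [ lra | apply Cmod_ge_0 ].
Qed.

Lemma is_C_ring_derive_comp (f g : C -> C) (z df dg : C) :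
  is_C_ring_derive f (g z) df -> is_C_ring_derive g z dg ->
  is_C_ring_derive (fun t => f (g t)) z (dg * df).
Proof. exact (@is_derive_comp C_AbsRing (AbsRing_NormedModule C_AbsRing) f g z df dg). Qed.

Lemma is_C_ring_derive_plus (f g : C -> C) (z df dg : C) :
  is_C_ring_derive f z df -> is_C_ring_derive g z dg ->
  is_C_ring_derive (fun t => f t + g t) z (df + dg).
Proof. exact (@is_derive_plus C_AbsRing (AbsRing_NormedModule C_AbsRing) f g z df dg). Qed.

Lemma is_C_ring_derive_scal_r (f : C -> C) (k z df : C) :
  is_C_ring_derive f z df -> is_C_ring_derive (fun t => f t * k) z (df * k).
Proof. exact (@is_derive_scal_l C_AbsRing (AbsRing_NormedModule C_AbsRing) f z df k). Qed.

Lemma is_C_ring_derive_mult (f g : C -> C) (z df dg : C) :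
  is_C_ring_derive f z df -> is_C_ring_derive g z dg ->
  is_C_ring_derive (fun t => f t * g t) z (df * g z + f z * dg).
Proof.
  intros Hf Hg; exact (is_derive_mult f g z df dg Hf Hg Cmult_comm).
Qed.

(** The remainder is [1/(z+h) - 1/z + h/z^2 = h^2 / (z^2 (z+h))]. For
    [|h| < |z|/2] the factor [z + h] stays at distance at least [|z|/2] from [0],
    so the remainder is at most [2 |h|^2 / |z|^3]. *)
Lemma is_C_ring_derive_inv (z : C) :
  z <> 0 -> is_C_ring_derive Cinv z (- / (z * z)).
Proof.
  intros Hz.
  pose proof (proj1 (Cmod_gt_0 z) Hz) as Hr.
  apply is_C_ring_derive_bound; intros eps Heps.
  set (r := Cmod z) in *.
  exists (Rmin (r / 2) (eps * (r * r * r) / 2)); split.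
  - apply Rmin_glb_lt; [ lra | ].
    assert (0 < eps * (r * r * r))%R by (repeat apply Rmult_lt_0_compat; lra).
    lra.
  - intros h Hh.
    pose proof (Rlt_le_trans _ _ _ Hh (Rmin_l _ _)) as Hh1.
    pose proof (Rlt_le_trans _ _ _ Hh (Rmin_r _ _)) as Hh2.
    assert (Hfar : (r / 2 < Cmod (z + h)%C)%R).
    { pose proof (Cmod_triangle (z + h) (- h)) as Htri.
      replace (z + h + - h) with z in Htri by ring.
      rewrite Cmod_opp in Htri; fold r in Htri; lra. }
    assert (Hzh : z + h <> 0) by (apply Cmod_gt_0; lra).
    replace (/ (z + h) - / z - h * - / (z * z))
      with (h * h / (z * z * (z + h))) by (field; auto).
    rewrite Cmod_div by (repeat apply Cmult_neq_0; assumption).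
    rewrite !Cmod_mult; fold r.
    set (a := Cmod h) in *; set (b := Cmod (z + h)) in *.
    assert (Ha : (0 <= a)%R) by apply Cmod_ge_0.
    assert (Hrrb : (0 < r * r * b)%R) by (repeat apply Rmult_lt_0_compat; lra).
    apply (Rmult_le_reg_r (r * r * b)); [ exact Hrrb | ].
    replace (a * a / (r * r * b) * (r * r * b))%R with (a * a)%R
      by (field; lra).
    assert (Hab : (a <= eps * (r * r * b))%R).
    { assert (eps * (r * r) * (r / 2) <= eps * (r * r) * b)%R; [ | lra ].
      apply Rmult_le_compat_l; [ | lra ].
      repeat apply Rmult_le_pos; lra. }
    replace (eps * a * (r * r * b))%R with (eps * (r * r * b) * a)%R by ring.
    apply Rmult_le_compat_r; assumption.
Qed.

(** * The complex exponential *)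

Lemma Cexp_plus (z w : C) : Cexp (z + w) = Cexp z * Cexp w.
Proof.
  destruct z as [x y], w as [u v].
  unfold Cexp, Cplus, Cmult; simpl.
  rewrite exp_plus, cos_plus, sin_plus.
  f_equal; ring.
Qed.

Lemma Cexp_0 : Cexp 0 = 1.
Proof.
  unfold Cexp; simpl.
  rewrite exp_0, cos_0, sin_0.
  unfold RtoC; f_equal; ring.
Qed.

Lemma Rderive_at_0_bound (f : R -> R) (l eps : R) :
  is_derive f 0%R l -> (0 < eps)%R ->
  exists delta : R, (0 < delta)%R /\
    forall x : R, (Rabs x < delta)%R ->
      (Rabs (f x - f 0 - x * l) <= eps * Rabs x)%R.
Proof.
  intros [_ Hdomin] Heps.
  destruct (Hdomin 0%R (fun P HP => HP) (mkposreal eps Heps)) as [delta Hd].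
  exists delta; split; [ apply cond_pos | intros x Hx ].
  assert (Hball : ball 0%R delta x).
  { change (Rabs (x - 0) < delta)%R; rewrite Rminus_0_r; exact Hx. }
  specialize (Hd x Hball).
  change (Rabs (f x - f 0 - (x - 0) * l) <= eps * Rabs (x - 0))%R in Hd.
  rewrite Rminus_0_r in Hd; exact Hd.
Qed.

(** Write [h = x + iy]. The two components of [Cexp h - 1 - h] split as
    [(e^x - 1 - x) cos y + (1 + x) (cos y - 1)] and
    [e^x (sin y - y) + (e^x - 1) y], where each summand contains a factor
    controlled by a real derivative at [0]. *)
Lemma Cexp_first_order (eps : R) :
  (0 < eps)%R ->
  exists delta : R, (0 < delta)%R /\
    forall h : C, (Cmod h < delta)%R ->
      (Cmod (Cexp h - 1 - h)%C <= eps * Cmod h)%R.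
Proof.
  intros Heps.
  (* The components are bounded by 3 eta |h| and 5 eta |h|; passing to the modulus
     costs a factor sqrt 2 <= 2, hence eta <= eps / 10. The bound eta <= 1
     keeps e^x and 1 + x bounded. *)
  pose (eta := (Rmin 1 (eps / 10))%R).
  assert (Heta : (0 < eta)%R) by (apply Rmin_glb_lt; lra).
  assert (Heta1 : (eta <= 1)%R) by apply Rmin_l.
  assert (Heta2 : (eta <= eps / 10)%R) by apply Rmin_r.
  clearbody eta.
  pose proof (is_derive_exp 0%R) as De; rewrite exp_0 in De.
  pose proof (is_derive_cos 0%R) as Dc; rewrite sin_0, Ropp_0 in Dc.
  pose proof (is_derive_sin 0%R) as Ds; rewrite cos_0 in Ds.
  destruct (Rderive_at_0_bound _ _ _ De Heta) as [d1 [Hd1 He]].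
  destruct (Rderive_at_0_bound _ _ _ Dc Heta) as [d2 [Hd2 Hc]].
  destruct (Rderive_at_0_bound _ _ _ Ds Heta) as [d3 [Hd3 Hs]].
  exists (Rmin (Rmin d1 d2) (Rmin d3 eta)); split.
  - repeat apply Rmin_glb_lt; assumption.
  - intros [x y] Hh.
    pose proof (Rmax_Cmod (x, y)) as Hmax; simpl in Hmax.
    set (m := Cmod (x, y)) in *.
    pose proof (Rle_trans _ _ _ (Rmax_l _ _) Hmax) as Hx.
    pose proof (Rle_trans _ _ _ (Rmax_r _ _) Hmax) as Hy.
    pose proof (Rmin_l (Rmin d1 d2) (Rmin d3 eta)) as M1.
    pose proof (Rmin_r (Rmin d1 d2) (Rmin d3 eta)) as M2.
    pose proof (Rmin_l d1 d2) as M3. pose proof (Rmin_r d1 d2) as M4.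
    pose proof (Rmin_l d3 eta) as M5. pose proof (Rmin_r d3 eta) as M6.
    specialize (He x ltac:(lra)); specialize (Hc y ltac:(lra)).
    specialize (Hs y ltac:(lra)).
    rewrite exp_0, Rmult_1_r in He.
    rewrite cos_0, Rmult_0_r, Rminus_0_r in Hc.
    rewrite sin_0, Rminus_0_r, Rmult_1_r in Hs.
    assert (Hm : (m < eta)%R) by lra.
    pose proof (Rabs_pos x) as Px. pose proof (Rabs_pos y) as Py.
    assert (He' : (Rabs (exp x - 1 - x) <= eta * m)%R).
    { eapply Rle_trans; [ exact He | apply Rmult_le_compat_l; lra ]. }
    assert (Hc' : (Rabs (cos y - 1) <= eta * m)%R).
    { eapply Rle_trans; [ exact Hc | apply Rmult_le_compat_l; lra ]. }
    assert (Hs' : (Rabs (sin y - y) <= eta * m)%R).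
    { eapply Rle_trans; [ exact Hs | apply Rmult_le_compat_l; lra ]. }
    assert (Hm1 : (eta * m <= m)%R).
    { rewrite <- (Rmult_1_l m) at 2; apply Rmult_le_compat_r; lra. }
    assert (Hx1 : (Rabs (1 + x) <= 2)%R).
    { eapply Rle_trans; [ apply Rabs_triang | rewrite Rabs_R1; lra ]. }
    assert (Hcos : (Rabs (cos y) <= 1)%R).
    { apply Rabs_le; pose proof (COS_bound y); lra. }
    assert (Hex : (Rabs (exp x) <= 3)%R).
    { replace (exp x) with ((exp x - 1 - x) + (1 + x))%R by ring.
      eapply Rle_trans; [ apply Rabs_triang | lra ]. }
    assert (Hex1 : (Rabs (exp x - 1) <= 2 * eta)%R).
    { replace (exp x - 1)%R with ((exp x - 1 - x) + x)%R by ring.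
      eapply Rle_trans; [ apply Rabs_triang | lra ]. }
    assert (HRe : (Rabs (exp x * cos y - 1 - x) <= 3 * (eta * m))%R).
    { replace (exp x * cos y - 1 - x)%R
        with ((exp x - 1 - x) * cos y + (1 + x) * (cos y - 1))%R by ring.
      eapply Rle_trans; [ apply Rabs_triang | rewrite !Rabs_mult ].
      replace (3 * (eta * m))%R with ((eta * m) * 1 + 2 * (eta * m))%R by ring.
      apply Rplus_le_compat; apply Rmult_le_compat; auto using Rabs_pos. }
    assert (HIm : (Rabs (exp x * sin y - y) <= 5 * (eta * m))%R).
    { replace (exp x * sin y - y)%R
        with (exp x * (sin y - y) + (exp x - 1) * y)%R by ring.
      eapply Rle_trans; [ apply Rabs_triang | rewrite !Rabs_mult ].
      replace (5 * (eta * m))%R with (3 * (eta * m) + (2 * eta) * m)%R by ring.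
      apply Rplus_le_compat; apply Rmult_le_compat; auto using Rabs_pos. }
    eapply Rle_trans; [ apply Cmod_2Rmax | ].
    assert (Hmaxb : (Rmax (Rabs (fst (Cexp (x, y) - 1 - (x, y))%C))
                     (Rabs (snd (Cexp (x, y) - 1 - (x, y))%C)) <= 5 * (eta * m))%R).
    { unfold Cexp, Cminus, Cplus, Copp, RtoC; simpl.
      apply Rmax_lub.
      - replace (exp x * cos y + - (1) + - x)%R
          with (exp x * cos y - 1 - x)%R by ring.
        assert (0 <= eta * m)%R by (apply Rmult_le_pos; lra); lra.
      - replace (exp x * sin y + - 0 + - y)%R
          with (exp x * sin y - y)%R by ring.
        exact HIm. }
    assert (Hsqrt : (sqrt 2 <= 2)%R).
    { rewrite <- (sqrt_Rsqr 2) at 2 by lra.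
      apply sqrt_le_1_alt; unfold Rsqr; lra. }
    assert (Hm0 : (0 <= m)%R) by lra.
    apply Rle_trans with (2 * (5 * (eta * m)))%R.
    + apply Rmult_le_compat; auto using sqrt_pos.
      eapply Rle_trans; [ apply Rabs_pos | apply Rmax_l ].
    + assert (eta * m <= eps / 10 * m)%R by (apply Rmult_le_compat_r; lra).
      assert (0 <= eps * m)%R by (apply Rmult_le_pos; lra).
      lra.
Qed.

(** By the addition formula the remainder at [z] is [Cexp z] times the remainder
    at [0]. *)
Lemma is_C_ring_derive_Cexp (z : C) : is_C_ring_derive Cexp z (Cexp z).
Proof.
  apply is_C_ring_derive_bound; intros eps Heps.
  set (M := (Cmod (Cexp z) + 1)%R).
  assert (HM : (0 < M)%R) by (pose proof (Cmod_ge_0 (Cexp z)); unfold M; lra).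
  destruct (Cexp_first_order (eps / M)) as [delta [Hdelta Hbound]].
  { apply Rdiv_lt_0_compat; assumption. }
  exists delta; split; [ exact Hdelta | intros h Hh ].
  rewrite Cexp_plus.
  replace (Cexp z * Cexp h - Cexp z - h * Cexp z)
    with (Cexp z * (Cexp h - 1 - h)) by ring.
  rewrite Cmod_mult.
  replace (eps * Cmod h)%R with (M * (eps / M * Cmod h))%R by (field; lra).
  apply Rmult_le_compat; auto using Cmod_ge_0.
  unfold M; lra.
Qed.

Lemma is_C_ring_derive_Cexp_opp (z : C) :
  is_C_ring_derive (fun t => Cexp (- t)) z (- Cexp (- z)).
Proof.
  apply (is_derive_ext (K := C_AbsRing) (V := AbsRing_NormedModule C_AbsRing)
           (fun t : C => Cexp (- (1) * t + 0))).
  { intros t; f_equal; ring. }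
  eapply is_C_ring_derive_eq.
  { apply (is_C_ring_derive_comp Cexp (fun t => - (1) * t + 0)).
    - apply is_C_ring_derive_Cexp.
    - apply is_C_ring_derive_affine. }
  simpl; replace (- (1) * z + 0) with (- z) by ring; ring.
Qed.

(** * Hyperbolic functions *)

Lemma is_C_ring_derive_Ccosh (z : C) : is_C_ring_derive Ccosh z (Csinh z).
Proof.
  apply (is_C_ring_derive_scal_r (fun t => Cexp t + Cexp (- t))).
  apply is_C_ring_derive_plus;
    [ apply is_C_ring_derive_Cexp | apply is_C_ring_derive_Cexp_opp ].
Qed.

Lemma is_C_ring_derive_Csinh (z : C) : is_C_ring_derive Csinh z (Ccosh z).
Proof.
  apply (is_C_ring_derive_scal_r (fun t => Cexp t - Cexp (- t))).
  replace (Cexp z + Cexp (- z)) with (Cexp z - - Cexp (- z)) by ring.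
  exact (@is_derive_minus C_AbsRing (AbsRing_NormedModule C_AbsRing) Cexp (fun t => Cexp (- t)) z _ _
           (is_C_ring_derive_Cexp z) (is_C_ring_derive_Cexp_opp z)).
Qed.

Lemma is_C_ring_derive_Ctanh (z : C) :
  Ccosh z <> 0 -> is_C_ring_derive Ctanh z (1 - Ctanh z * Ctanh z).
Proof.
  intros Hz.
  eapply is_C_ring_derive_eq.
  { apply (is_C_ring_derive_mult Csinh (fun t => / Ccosh t)).
    - apply is_C_ring_derive_Csinh.
    - apply (is_C_ring_derive_comp Cinv Ccosh).
      + apply is_C_ring_derive_inv; exact Hz.
      + apply is_C_ring_derive_Ccosh. }
  unfold Ctanh; field; exact Hz.
Qed.

(** Openness refers to the product structure of the plane and continuity of a
    differentiable function to the one induced by [Cmod]; [locally_C] says that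
    they have the same neighbourhoods. *)
Lemma open_Ccosh_affine_neq_0 (a b : C) :
  open (fun t : C => Ccosh (a * t + b) <> 0).
Proof.
  intros t Ht.
  apply locally_C.
  assert (Hd : is_C_ring_derive (fun t => Ccosh (a * t + b)) t
                 (a * Csinh (a * t + b))).
  { apply (is_C_ring_derive_comp Ccosh (fun t => a * t + b)).
    - apply is_C_ring_derive_Ccosh.
    - apply is_C_ring_derive_affine. }
  apply (ex_derive_continuous (K := C_AbsRing)
           (V := AbsRing_NormedModule C_AbsRing)
           (fun t : C => Ccosh (a * t + b)) t (ex_intro _ _ Hd)
           (fun w : C => w <> 0)).
  (* The disc of radius |w0| around w0 <> 0 does not contain 0. *)
  exists (mkposreal _ (proj1 (Cmod_gt_0 _) Ht)).
  intros w Hw Hw0; subst w.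
  change (Cmod (0 - Ccosh (a * t + b))%C < Cmod (Ccosh (a * t + b)%C))%R in Hw.
  replace (0 - Ccosh (a * t + b)) with (- Ccosh (a * t + b)) in Hw by ring.
  rewrite Cmod_opp in Hw; lra.
Qed.

Lemma Ccosh_0 : Ccosh 0 = 1.
Proof.
  unfold Ccosh; replace (- 0) with (RtoC 0) by ring.
  rewrite Cexp_0; field.
Qed.

(** * The special solution *)

Theorem mainTheorem3 : forall c1 c2 : C,
  is_solution_on
    (fun t : C => Ccosh (6 * (c1 * t - c1 * c2)) <> 0)%C
    (fun _ : C => c1)
    (fun _ : C => RtoC 0)
    (fun t : C => - 6 * c1 * Ctanh (6 * (c1 * t - c1 * c2)) - 4 * c1)%C.
Proof.
  intros c1 c2.
  assert (Harg : forall t, 6 * (c1 * t - c1 * c2)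
                           = 6 * c1 * t + - (6 * c1 * c2)) by (intros; ring).
  split; [ | split ].
  - apply (open_ext (fun t : C => Ccosh (6 * c1 * t + - (6 * c1 * c2)) <> 0)).
    { intros t; rewrite Harg; tauto. }
    apply open_Ccosh_affine_neq_0.
  - exists c2.
    replace (6 * (c1 * c2 - c1 * c2)) with (RtoC 0) by ring.
    rewrite Ccosh_0; exact C1_nz.
  - intros t Ht.
    split; [ | split ].
    + replace (- c1 * 0) with (RtoC 0) by ring.
      exact (is_derive_const (K := C_AbsRing) (V := C_NormedModule) c1 t).
    + match goal with |- is_C_derive _ _ ?l =>
        replace l with (RtoC 0) by ring end.
      exact (is_derive_const (K := C_AbsRing) (V := C_NormedModule) (RtoC 0) t).
    + apply is_C_derive_of_ring.
      eapply is_C_ring_derive_eq.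
      { apply (is_C_ring_derive_comp (fun w => - 6 * c1 * w + - (4 * c1))
                 (fun t => Ctanh (6 * (c1 * t - c1 * c2)))).
        - apply is_C_ring_derive_affine.
        - apply (is_C_ring_derive_comp Ctanh
                   (fun t => 6 * (c1 * t - c1 * c2))).
          + apply is_C_ring_derive_Ctanh; exact Ht.
          + apply (is_derive_ext (K := C_AbsRing)
                     (V := AbsRing_NormedModule C_AbsRing)
                     (fun t : C => 6 * c1 * t + - (6 * c1 * c2))).
            { intros s; symmetry; apply Harg. }
            apply is_C_ring_derive_affine. }
      simpl; ring.
Qed.
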